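(* Let $(X,d)$ be an $f$-complete asymmetric space and let $T:X\to X$ be a mapping such that the iterate $T^k$ is an $f$-contraction for some positive integer $k$. Suppose that $f$-convergence implies $b$-convergence. Then $T$ has a unique fixed point.
   Context: An asymmetric distance on a non-empty set $X$ is a function $d:X\times X\to\mathbb{R}$ such that for all $x,y,z\in X$: $d(x,y)\ge 0$; $d(x,y)=d(y,x)=0$ if and only if $x=y$; and $d(x,z)\le d(x,y)+d(y,z)$. (Symmetry is not required.) The pair $(X,d)$ is then called an asymmetric space. A sequence $\{x_n\}$ $f$-converges to $x$ if $d(x,x_n)\to 0$, and $b$-converges to $x$ if $d(x_n,x)\to 0$. ''$f$-convergence implies $b$-convergence'' means that whenever $\{x_n\}$ $f$-converges to $x$, it also $b$-converges to $x$. A sequence $\{x_n\}$ is $f$-Cauchy if for all $\epsilon>0$ there is $N$ such that $d(x_n,x_m)<\epsilon$ whenever $m\ge n\ge N$. The space is $f$-complete (forward complete) if every $f$-Cauchy sequence is $f$-convergent in $X$. A map $S:X\to X$ is an $f$-contraction if there is a constant $0\le c<1$ with $d(Sx,Sy)\le c\,d(x,y)$ for all $x,y\in X$. *)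

(* Defs.v *)
From Stdlib Require Import Reals.
Open Scope R_scope.

Record asym_distance {X : Type} (d : X -> X -> R) : Prop := {
  asym_nonneg : forall x y, 0 <= d x y;
  asym_eq0 : forall x y, (d x y = 0 /\ d y x = 0) <-> x = y;
  asym_triangle : forall x y z, d x z <= d x y + d y z
}.

(* The carrier of an asymmetric space is required to be non-empty. *)
Definition asym_space (X : Type) (d : X -> X -> R) : Prop :=
  inhabited X /\ asym_distance d.

(* The order of the arguments of [d] matters: the limit comes first in
   f-convergence and second in b-convergence. *)
Definition f_converges {X : Type} (d : X -> X -> R) (u : nat -> X) (x : X) : Prop :=
  Un_cv (fun n => d x (u n)) 0.

Definition b_converges {X : Type} (d : X -> X -> R) (u : nat -> X) (x : X) : Prop :=
  Un_cv (fun n => d (u n) x) 0.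

Definition f_implies_b {X : Type} (d : X -> X -> R) : Prop :=
  forall (u : nat -> X) (x : X), f_converges d u x -> b_converges d u x.

Definition f_Cauchy {X : Type} (d : X -> X -> R) (u : nat -> X) : Prop :=
  forall eps : R, 0 < eps ->
    exists N : nat, forall n m : nat,
      (N <= n)%nat -> (n <= m)%nat -> d (u n) (u m) < eps.

Definition f_complete {X : Type} (d : X -> X -> R) : Prop :=
  forall u : nat -> X, f_Cauchy d u -> exists x : X, f_converges d u x.

Definition f_contraction {X : Type} (d : X -> X -> R) (S : X -> X) : Prop :=
  exists c : R, (0 <= c < 1) /\ forall x y : X, d (S x) (S y) <= c * d x y.

(* Main.v *)
Require Import Defs.
From Stdlib Require Import Reals.
From Stdlib Require Import Lra Lia.

(** Write [S] for the contracting iterate of [T], with constant [c]. The orbit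
    of a point [x0] under [S] stays within forward distance
    [d x0 (S x0) / (1 - c)] of [x0] ([orbit_bounded]); shifting this bound by
    [S^n] multiplies it by [c^n], so the orbit is f-Cauchy ([orbit_f_Cauchy])
    and f-converges to some [x]. In an asymmetric space, [S x = x] requires both
    [d x (S x) = 0] and [d (S x) x = 0]; each estimate passes through the orbit
    once in the forward and once in the backward direction, which is why
    f-convergence has to imply b-convergence ([contraction_fixed_point]).
    A contraction has at most one fixed point, and [T] commutes with its
    iterate [S], so [T x] is a fixed point of [S] too, whence [T x = x]. *)

Section Contraction.

Variables (X : Type) (d : X -> X -> R) (S : X -> X) (c : R).
Hypothesis d_asym : asym_distance d.
Hypothesis c_range : 0 <= c < 1.
Hypothesis S_contr : forall x y, d (S x) (S y) <= c * d x y.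

Lemma iter_contraction (n : nat) (x y : X) :
  d (Nat.iter n S x) (Nat.iter n S y) <= c ^ n * d x y.
Proof.
  induction n as [|n IH]; simpl; [lra|].
  apply Rle_trans with (1 := S_contr _ _).
  rewrite Rmult_assoc.
  now apply Rmult_le_compat_l.
Qed.

(** The bound [K := d x0 (S x0) / (1 - c)] solves [d x0 (S x0) + c * K = K], so
    the triangle inequality through [S x0] reproduces it at each step. *)
Lemma orbit_bounded (x0 : X) (n : nat) :
  d x0 (Nat.iter n S x0) <= d x0 (S x0) / (1 - c).
Proof.
  set (K := d x0 (S x0) / (1 - c)).
  assert (K_fix : d x0 (S x0) + c * K = K) by (unfold K; field; lra).
  induction n as [|n IH]; simpl.
  - rewrite (proj1 (proj2 (asym_eq0 d d_asym x0 x0) eq_refl)).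
    apply Rle_mult_inv_pos; [apply (asym_nonneg d d_asym) | lra].
  - pose proof (asym_triangle d d_asym x0 (S x0) (S (Nat.iter n S x0))) as Htri.
    pose proof (S_contr x0 (Nat.iter n S x0)) as HS.
    pose proof (Rmult_le_compat_l c _ _ (proj1 c_range) IH) as Hc.
    lra.
Qed.

Lemma orbit_f_Cauchy (x0 : X) : f_Cauchy d (fun n => Nat.iter n S x0).
Proof.
  intros eps eps_pos.
  set (K := d x0 (S x0) / (1 - c)).
  assert (K_nonneg : 0 <= K).
  { apply Rle_mult_inv_pos; [apply (asym_nonneg d d_asym) | lra]. }
  (* [K] may vanish, hence the denominator [K + 1]. *)
  assert (c_abs : Rabs c < 1) by (rewrite Rabs_right; lra).
  assert (delta_pos : 0 < eps / (K + 1)) by (apply Rdiv_lt_0_compat; lra).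
  destruct (pow_lt_1_zero c c_abs _ delta_pos) as [N HN].
  exists N; intros n m HNn Hnm.
  replace m with (n + (m - n))%nat by lia.
  rewrite Nat.iter_add.
  apply Rle_lt_trans with (1 := iter_contraction n _ _).
  pose proof (pow_le c n (proj1 c_range)) as cn_nonneg.
  pose proof (Rle_lt_trans _ _ _ (Rle_abs _) (HN n HNn)) as cn_small.
  pose proof (Rmult_le_compat_l _ _ _ cn_nonneg (orbit_bounded x0 (m - n))) as H1.
  fold K in H1.
  pose proof (Rmult_le_compat_r K _ _ K_nonneg (Rlt_le _ _ cn_small)) as H2.
  assert (Hsplit : eps / (K + 1) * K + eps / (K + 1) = eps) by (field; lra).
  lra.
Qed.

Lemma contraction_dist_fixed (x y : X) : S x = x -> S y = y -> d x y = 0.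
Proof.
  intros Hx Hy.
  pose proof (S_contr x y) as H; rewrite Hx, Hy in H.
  pose proof (asym_nonneg d d_asym x y).
  nra.
Qed.

Lemma contraction_fixed_unique (x y : X) : S x = x -> S y = y -> x = y.
Proof.
  intros Hx Hy; apply (asym_eq0 d d_asym).
  split; now apply contraction_dist_fixed.
Qed.

Lemma contraction_fixed_point :
  inhabited X -> f_complete d -> f_implies_b d -> exists x, S x = x.
Proof.
  intros [x0] Hcomplete Hfb.
  set (u := fun n => Nat.iter n S x0).
  destruct (Hcomplete u (orbit_f_Cauchy x0)) as [x Hf].
  pose proof (Hfb u x Hf) as Hb.
  exists x.
  assert (close : forall eps, 0 < eps -> exists n,
    d x (u n) < eps /\ d (u n) x < eps /\
    d x (S (u n)) < eps /\ d (S (u n)) x < eps).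
  { intros eps eps_pos.
    destruct (Hf eps eps_pos) as [N1 H1], (Hb eps eps_pos) as [N2 H2].
    assert (Hf_lt : forall n, (n >= N1)%nat -> d x (u n) < eps).
    { intros n Hn; specialize (H1 n Hn); unfold Rdist in H1.
      rewrite Rminus_0_r in H1; exact (Rle_lt_trans _ _ _ (Rle_abs _) H1). }
    assert (Hb_lt : forall n, (n >= N2)%nat -> d (u n) x < eps).
    { intros n Hn; specialize (H2 n Hn); unfold Rdist in H2.
      rewrite Rminus_0_r in H2; exact (Rle_lt_trans _ _ _ (Rle_abs _) H2). }
    exists (N1 + N2)%nat; change (S (u (N1 + N2)%nat)) with (u (1 + (N1 + N2))%nat).
    repeat split; (apply Hf_lt || apply Hb_lt); lia. }
  apply (asym_eq0 d d_asym).
  split; (apply Rle_antisym; [|apply (asym_nonneg d d_asym)]);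
    apply le_epsilon; intros eps eps_pos;
    destruct (close (eps / 2) ltac:(lra)) as (n & Hxu & Hux & HxSu & HSux).
  - pose proof (asym_triangle d d_asym (S x) (S (u n)) x).
    pose proof (S_contr x (u n)).
    pose proof (asym_nonneg d d_asym x (u n)).
    nra.
  - pose proof (asym_triangle d d_asym x (S (u n)) (S x)).
    pose proof (S_contr (u n) x).
    pose proof (asym_nonneg d d_asym (u n) x).
    nra.
Qed.

End Contraction.

Lemma iter_fixed {X : Type} (T : X -> X) (n : nat) (x : X) :
  T x = x -> Nat.iter n T x = x.
Proof.
  intros Hx; induction n as [|n IH]; simpl; [reflexivity | now rewrite IH].
Qed.

Theorem mainTheorem5 (X : Type) (d : X -> X -> R)
  (hX : asym_space X d) (hcomplete : f_complete d)
  (T : X -> X)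
  (hT : exists k : nat, (0 < k)%nat /\ f_contraction d (Nat.iter k T))
  (hfb : f_implies_b d) :
  exists! x : X, T x = x.
Proof.
  destruct hX as [Xne d_asym].
  destruct hT as (k & _ & c & c_range & S_contr).
  destruct (contraction_fixed_point X d _ c d_asym c_range S_contr
              Xne hcomplete hfb) as [x Hx].
  pose proof (contraction_fixed_unique X d _ c d_asym c_range S_contr) as Huniq.
  exists x; split.
  - apply Huniq; [|exact Hx].
    rewrite Nat.iter_swap, Hx; reflexivity.
  - intros y Hy; apply Huniq; [exact Hx | now apply iter_fixed].
Qed.
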